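(* Let $n,m,k$ be positive integers with $k\le m$, and let $\bar{\mathbf a}=(\bar{\mathbf a}^1,\dots,\bar{\mathbf a}^m)\in\mathbb R^{n\times m}$ be such that $\bar{\mathbf a}^1,\dots,\bar{\mathbf a}^m$ are pairwise distinct. Then the global solution map $F:\mathbb R^{n\times m}\rightrightarrows\mathbb R^{n\times k}$ defined in the context is locally upper Lipschitz at $\bar{\mathbf a}$, i.e., there exist $L>0$ and $\delta>0$ such that $$F(\mathbf a)\subset F(\bar{\mathbf a})+L\|\mathbf a-\bar{\mathbf a}\|\,\bar B_{\mathbb R^{n\times k}}$$ for all $\mathbf a\in\mathbb R^{n\times m}$ satisfying $\|\mathbf a-\bar{\mathbf a}\|<\delta$.
   Context: $\mathbb R^n$ carries the Euclidean norm. Elements of $\mathbb R^{n\times m}$ are written $\mathbf a=({\mathbf a}^1,\dots,{\mathbf a}^m)$ with ${\mathbf a}^i\in\mathbb R^n$, and elements of $\mathbb R^{n\times k}$ are written $\mathbf x=({\mathbf x}^1,\dots,{\mathbf x}^k)$ with ${\mathbf x}^j\in\mathbb R^n$. These product spaces are equipped with the sum norms $\|\mathbf a\|=\sum_{i=1}^m\|{\mathbf a}^i\|$ and $\|\mathbf x\|=\sum_{j=1}^k\|{\mathbf x}^j\|$. $\bar B_{\mathbb R^{n\times k}}=\{\mathbf x\in\mathbb R^{n\times k}\mid\sum_{j=1}^k\|{\mathbf x}^j\|\le1\}$ is the closed unit ball. Put $$f(\mathbf x,\mathbf a)=\frac1m\sum_{i=1}^m\Big(\min_{j=1,\dots,k}\|{\mathbf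 a}^i-{\mathbf x}^j\|^2\Big),\qquad v(\mathbf a)=\min\{f(\mathbf x,\mathbf a)\mid\mathbf x\in\mathbb R^{n\times k}\}.$$ The global solution map is $F(\mathbf a)=\{\mathbf x\in\mathbb R^{n\times k}\mid f(\mathbf x,\mathbf a)=v(\mathbf a)\}$. *)

(* Defs.v *)
From HB Require Import structures.
From mathcomp Require Import all_boot all_order all_algebra.
From mathcomp Require Import all_classical all_reals.

Set Implicit Arguments.
Unset Strict Implicit.
Unset Printing Implicit Defensive.

Import Order.TTheory GRing.Theory Num.Theory.

Local Open Scope classical_set_scope.
Local Open Scope ring_scope.

(* A tuple of m vectors of R^n is the matrix 'M[R]_(n, m) of its columns: the
   i-th vector of a is col i a. *)

(* Defined by hand because the norm `|x| that MathComp-Analysis puts on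
   matrices is the maximum norm. *)
Definition enorm (R : realType) (n : nat) (x : 'cV[R]_n) : R :=
  Num.sqrt (\sum_(i < n) x i 0 ^+ 2).

Definition sum_norm (R : realType) (n p : nat) (x : 'M[R]_(n, p)) : R :=
  \sum_(j < p) enorm (col j x).

Definition sum_ball (R : realType) (n p : nat) : set 'M[R]_(n, p) :=
  [set x | sum_norm x <= 1].

(* For 0 < k, the minimum over j of |y - x^j|^2: see min_sqdistP. *)
Definition min_sqdist (R : realType) (n k : nat)
    (x : 'M[R]_(n, k)) (y : 'cV[R]_n) : R :=
  inf [set enorm (y - col j x) ^+ 2 | j in [set: 'I_k]].

Definition objective (R : realType) (n m k : nat)
    (x : 'M[R]_(n, k)) (a : 'M[R]_(n, m)) : R :=
  m%:R^-1 * \sum_(i < m) min_sqdist x (col i a).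

Definition optimal_value (R : realType) (n m k : nat) (a : 'M[R]_(n, m)) : R :=
  inf [set objective x a | x in [set: 'M[R]_(n, k)]].

(* The infimum in optimal_value is that of a nonempty set bounded below by 0,
   so the solution set is the set of global minimizers (see solution_mapP)
   whether or not the minimum is known to be attained. *)
Definition solution_map (R : realType) (n m k : nat)
    (a : 'M[R]_(n, m)) : set 'M[R]_(n, k) :=
  [set x | objective x a = optimal_value k a].

Definition locally_upper_lipschitz (R : realType) (n m k : nat)
    (F : 'M[R]_(n, m) -> set 'M[R]_(n, k)) (abar : 'M[R]_(n, m)) : Prop :=
  exists L delta : R, [/\ 0 < L, 0 < delta &
    forall a : 'M[R]_(n, m), sum_norm (a - abar) < delta ->
      F a `<=` [set x + (L * sum_norm (a - abar)) *: b
                 | x in F abar & b in @sum_ball R n k]].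

Lemma min_sqdistP (R : realType) (n k : nat)
    (x : 'M[R]_(n, k)) (y : 'cV[R]_n) : (0 < k)%N ->
  (exists j, min_sqdist x y = enorm (y - col j x) ^+ 2) /\
  (forall j, min_sqdist x y <= enorm (y - col j x) ^+ 2).
Proof.
move=> k0; set d := fun j => enorm (y - col j x) ^+ 2.
have lb0 : has_lbound [set d j | j in [set: 'I_k]].
  by exists 0 => _ [j _ <-]; exact: sqr_ge0.
have le j : min_sqdist x y <= d j by apply: ge_inf => //; exists j.
split=> //.
case: (arg_minP d (erefl : xpredT (Ordinal k0))) => j _ dj.
exists j; apply/eqP; rewrite eq_le le /=.
apply: lb_le_inf; first by exists (d j), j.
by move=> _ [i _ <-]; exact: dj.
Qed.

Lemma min_sqdist_ge0 (R : realType) (n k : nat)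
    (x : 'M[R]_(n, k)) (y : 'cV[R]_n) : 0 <= min_sqdist x y.
Proof.
case: k x => [|k] x.
  rewrite /min_sqdist (_ : image _ _ = set0) ?inf0 //.
  by apply/seteqP; split=> // z [[]].
by have [[j ->] _] := min_sqdistP x y (ltn0Sn k); exact: sqr_ge0.
Qed.

Lemma objective_ge0 (R : realType) (n m k : nat)
    (x : 'M[R]_(n, k)) (a : 'M[R]_(n, m)) : 0 <= objective x a.
Proof.
apply: mulr_ge0; first by rewrite invr_ge0 ler0n.
by apply: sumr_ge0 => i _; exact: min_sqdist_ge0.
Qed.

Lemma solution_mapP (R : realType) (n m k : nat)
    (a : 'M[R]_(n, m)) (x : 'M[R]_(n, k)) :
  solution_map a x <-> forall y : 'M[R]_(n, k), objective x a <= objective y a.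
Proof.
have le (y : 'M[R]_(n, k)) : optimal_value k a <= objective y a.
  apply: ge_inf; last by exists y.
  by exists 0 => _ [z _ <-]; exact: objective_ge0.
split=> [xopt y|xmin]; first by rewrite (xopt : _ = _).
apply/eqP; rewrite eq_le le andbT; apply: lb_le_inf.
  by exists (objective x a), x.
by move=> _ [z _ <-]; exact: xmin.
Qed.

(* Main.v *)
Require Import Defs.
From HB Require Import structures.
From mathcomp Require Import all_boot all_order all_algebra.
From mathcomp Require Import all_classical all_reals.
From mathcomp Require Import ring lra.

Set Implicit Arguments.
Unset Strict Implicit.
Unset Printing Implicit Defensive.

(** The constant [L = 1] works.  Write the objective as the minimum, over the
    finitely many assignments [s] of points to centers, of the cost of [s]:
    minimizing the objective over [x] then means minimizing the cost jointly over
    the pairs [(s, x)].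

    Let [x] be a solution for data [a] near [abar], and [s] an assignment of
    each point to a nearest center.  The points of [a] are still pairwise
    distinct and there are at least as many points as centers, so no center is
    idle ([jointly_optimal_surj]).  By the variance decomposition
    ([cost_centroid]), each center is then the centroid of its cluster, so that
    [x = centroid s a].

    For each fixed [s], the cost of [s] at its centroids depends continuously on
    the data.  If [(s, centroid s abar)] is not optimal for [abar], some pair
    with a strictly smaller cost keeps beating [s] for all data near [abar]
    ([jointly_optimal_centroid_stable]).  As there are finitely many [s], one
    radius serves them all: near [abar], an assignment that is optimal for [a] is
    already optimal for [abar], and [centroid s abar] is a solution for [abar].
    Finally, [centroid s] is linear and does not increase the sum norm
    ([sum_norm_centroid]), hence [|x - centroid s abar| <= |a - abar|]. *)

Import Order.TTheory GRing.Theory Num.Theory.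

Local Open Scope classical_set_scope.
Local Open Scope ring_scope.

(** * The Euclidean norm and the sum norm *)

Section Norms.
Variable R : realType.

Lemma sqr_enorm n (x : 'cV[R]_n) : enorm x ^+ 2 = \sum_(i < n) x i 0 ^+ 2.
Proof. by rewrite sqr_sqrtr ?sumr_ge0 // => i _; exact: sqr_ge0. Qed.

Lemma enorm_ge0 n (x : 'cV[R]_n) : 0 <= enorm x.
Proof. exact: sqrtr_ge0. Qed.

Lemma enorm0_eq0 n (x : 'cV[R]_n) : enorm x = 0 -> x = 0.
Proof.
move=> x0; have /eqP := sqr_enorm x; rewrite x0 expr0n eq_sym psumr_eq0; last first.
  by move=> i _; exact: sqr_ge0.
move=> /allP x_0; apply/colP => i; rewrite mxE; apply/eqP.
by rewrite -sqrf_eq0; exact: x_0 (mem_index_enum i).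
Qed.

Lemma enormZ n (c : R) (x : 'cV[R]_n) : enorm (c *: x) = `|c| * enorm x.
Proof.
rewrite /enorm -sqrtr_sqr -sqrtrM ?sqr_ge0 // mulr_sumr; congr Num.sqrt.
by apply: eq_bigr => i _; rewrite mxE exprMn.
Qed.

Lemma enorm0 n : enorm (0 : 'cV[R]_n) = 0.
Proof. by rewrite -(scale0r 0) enormZ normr0 mul0r. Qed.

Lemma enormN n (x : 'cV[R]_n) : enorm (- x) = enorm x.
Proof. by rewrite -scaleN1r enormZ normrN normr1 mul1r. Qed.

(** The nonnegative sum of the squares of [B x - C y], where [B = |y|^2] and
    [C = <x, y>], equals [B (|x|^2 |y|^2 - C^2)]. *)
Lemma cauchy_schwarz n (x y : 'cV[R]_n) :
  \sum_(i < n) x i 0 * y i 0 <= enorm x * enorm y.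
Proof.
set C := \sum_(i < n) _.
have [y0|y0] := eqVneq (enorm y) 0.
  rewrite y0 mulr0 /C (enorm0_eq0 y0) big1 // => i _.
  by rewrite mxE mulr0.
have y_gt0 : 0 < enorm y by rewrite lt_def y0 enorm_ge0.
set B := enorm y ^+ 2.
have : 0 <= \sum_(i < n) (B * x i 0 - C * y i 0) ^+ 2.
  by apply: sumr_ge0 => i _; exact: sqr_ge0.
have -> : \sum_(i < n) (B * x i 0 - C * y i 0) ^+ 2 =
          B * (enorm x ^+ 2 * B - C ^+ 2).
  transitivity (\sum_(i < n) (B ^+ 2 * x i 0 ^+ 2 -
      2 * B * C * (x i 0 * y i 0) + C ^+ 2 * y i 0 ^+ 2)).
    by apply: eq_bigr => i _; ring.
  rewrite big_split /= sumrB -!mulr_sumr -!sqr_enorm -/C -/B.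
  by ring.
rewrite pmulr_rge0 ?exprn_gt0 // subr_ge0 -exprMn => le_sqr.
apply: le_trans (ler_norm _) _.
by rewrite -ler_sqr ?nnegrE ?mulr_ge0 ?enorm_ge0 // real_normK ?num_real.
Qed.

Lemma enormD n (x y : 'cV[R]_n) : enorm (x + y) <= enorm x + enorm y.
Proof.
rewrite -ler_sqr ?nnegrE ?addr_ge0 ?enorm_ge0 //.
have -> : enorm (x + y) ^+ 2 =
    enorm x ^+ 2 + 2 * (\sum_(i < n) x i 0 * y i 0) + enorm y ^+ 2.
  rewrite !sqr_enorm mulr_sumr -!big_split /=.
  by apply: eq_bigr => i _; rewrite mxE; ring.
by have := cauchy_schwarz x y; rewrite sqrrD; lra.
Qed.

Lemma enorm_sum n (I : finType) (P : pred I) (F : I -> 'cV[R]_n) :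
  enorm (\sum_(i | P i) F i) <= \sum_(i | P i) enorm (F i).
Proof.
elim/big_rec2: _ => [|i y1 y2 _ le12]; first by rewrite enorm0.
by apply: le_trans (enormD _ _) _; rewrite lerD2l.
Qed.

Lemma sum_norm_ge0 n p (x : 'M[R]_(n, p)) : 0 <= sum_norm x.
Proof. by apply: sumr_ge0 => j _; exact: enorm_ge0. Qed.

Lemma enorm_col_le n p (x : 'M[R]_(n, p)) j : enorm (col j x) <= sum_norm x.
Proof.
rewrite /sum_norm (bigD1 j) //= lerDl.
by apply: sumr_ge0 => i _; exact: enorm_ge0.
Qed.

Lemma enorm_col2_le n p (x : 'M[R]_(n, p)) i j : i != j ->
  enorm (col i x) + enorm (col j x) <= sum_norm x.
Proof.
move=> ij; rewrite /sum_norm (bigD1 i) //= (bigD1 j) /=; last by rewrite eq_sym.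
by rewrite lerD2l lerDl; apply: sumr_ge0 => l _; exact: enorm_ge0.
Qed.

Lemma sum_normZ n p (c : R) (x : 'M[R]_(n, p)) :
  sum_norm (c *: x) = `|c| * sum_norm x.
Proof.
rewrite /sum_norm mulr_sumr; apply: eq_bigr => j _.
by rewrite -enormZ linearZ.
Qed.

Lemma sum_norm_le0 n p (x : 'M[R]_(n, p)) : sum_norm x <= 0 -> x = 0.
Proof.
move=> x0; apply/matrixP => i j.
have /enorm0_eq0/colP/(_ i) : enorm (col j x) = 0.
  by apply/eqP; rewrite eq_le enorm_ge0 (le_trans (enorm_col_le x j)).
by rewrite !mxE.
Qed.

Lemma sum_norm0 n p : sum_norm (0 : 'M[R]_(n, p)) = 0.
Proof. by rewrite -(scale0r 0) sum_normZ normr0 mul0r. Qed.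

(** Turns a norm bound into membership in a dilated unit ball; for [r = 0] the
    ball shrinks to a point and [z] must vanish. *)
Lemma sum_ball_dilate n p (r : R) (z : 'M[R]_(n, p)) :
  sum_norm z <= r -> exists2 b, @sum_ball R n p b & z = r *: b.
Proof.
move=> zr; have := le_trans (sum_norm_ge0 z) zr.
rewrite le_eqVlt => /orP[/eqP r0|r_gt0].
  exists 0; first by rewrite /sum_ball /= sum_norm0 ler01.
  by rewrite scaler0; apply: sum_norm_le0; rewrite r0.
exists (r^-1 *: z); last by rewrite scalerA divff ?gt_eqF // scale1r.
by rewrite /sum_ball /= sum_normZ gtr0_norm ?invr_gt0 // mulrC ler_pdivrMr ?mul1r.
Qed.

(** The difference of squares is at most [|v - u| (|v| + |u|)], hence at most
    [2 r (2 |u| + 2 r)], and [r <= 1] makes this linear in [r]. *)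
Lemma dist_sqr_enorm n (u v : 'cV[R]_n) (r : R) :
  enorm (v - u) <= 2 * r -> r <= 1 ->
  `|enorm v ^+ 2 - enorm u ^+ 2| <= 4 * (enorm u + 1) * r.
Proof.
move=> vu r1.
have h1 := enormD (v - u) u; rewrite subrK in h1.
have h2 := enormD (u - v) v; rewrite subrK -opprB enormN in h2.
have := enorm_ge0 u; have := enorm_ge0 v; have := enorm_ge0 (v - u).
move: (enorm v) (enorm u) (enorm (v - u)) vu h1 h2 => V U D *.
by rewrite ler_norml; nra.
Qed.

End Norms.

(** * Clustering cost of an assignment *)

Section Cost.
Variables (R : realType) (n m k : nat).
Implicit Types (a : 'M[R]_(n, m)) (x y : 'M[R]_(n, k)) (s : {ffun 'I_m -> 'I_k}).

Definition cost s x a : R :=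
  \sum_(i < m) enorm (col i a - col (s i) x) ^+ 2.

Lemma objective_le_cost s x a :
  objective x a <= m%:R^-1 * cost s x a.
Proof.
apply: ler_wpM2l; first by rewrite invr_ge0 ler0n.
apply: ler_sum => i _.
have k_gt0 : (0 < k)%N by case: (k) (s i) => [[]|].
by have [_] := min_sqdistP x (col i a) k_gt0.
Qed.

Lemma nearest_assignment x a : (0 < k)%N ->
  exists s, objective x a = m%:R^-1 * cost s x a.
Proof.
move=> k_gt0.
have /choice[s sP] : forall i, exists j,
    min_sqdist x (col i a) = enorm (col i a - col j x) ^+ 2.
  by move=> i; have [] := min_sqdistP x (col i a) k_gt0.
exists (finfun s); congr (_ * _); apply: eq_bigr => i _.
by rewrite sP ffunE.
Qed.

(** Optimality over assignments and centers together.  The inner minimum over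
    centers disappears, and the cost left is a sum of squares. *)
Definition jointly_optimal s x a : Prop :=
  forall t y, cost s x a <= cost t y a.

Lemma solution_map_assignment x a : (0 < m)%N -> (0 < k)%N ->
  solution_map a x -> exists s, jointly_optimal s x a.
Proof.
move=> m_gt0 k_gt0 /solution_mapP xmin.
have [s es] := nearest_assignment x a k_gt0.
exists s => t y; have m_inv : 0 < m%:R^-1 :> R by rewrite invr_gt0 ltr0n.
rewrite -(ler_pM2l m_inv) -es.
exact: le_trans (xmin y) (objective_le_cost t y a).
Qed.

Lemma jointly_optimal_solution s x a : (0 < k)%N ->
  jointly_optimal s x a -> solution_map a x.
Proof.
move=> k_gt0 sx; apply/solution_mapP => y.
have [t ->] := nearest_assignment y a k_gt0.
apply: le_trans (objective_le_cost s x a) _.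
by apply: ler_wpM2l; rewrite ?invr_ge0 ?ler0n.
Qed.

(** If a center [j] receives no point, the pigeonhole principle puts two
    distinct points in one cluster, so one of them is not at its center.  Moving
    the idle center onto that point strictly lowers the cost. *)
Lemma jointly_optimal_surj s x a : (k <= m)%N ->
  (forall i j : 'I_m, i != j -> col i a != col j a) ->
  jointly_optimal s x a -> forall j, exists i, s i = j.
Proof.
move=> le_k_m a_distinct opt j; apply: contrapT => idle.
have s_j i : s i != j by apply/eqP => sij; apply: idle; exists i.
have [i off_center] : exists i, col i a != col (s i) x.
  have /injectivePn[i1 [i2 i12 s12]] : ~~ injectiveb s.
    apply/negP => /injectiveP s_inj.
    have : (#|codom s| < k)%N.
      rewrite -[X in (_ < X)%N]card_ord; apply/proper_card/properP.
      split; first exact: subset_predT.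
      by exists j => //; apply/codomP => -[i ji]; apply: idle; exists i.
    by rewrite card_codom // card_ord ltnNge le_k_m.
  have [e1|] := eqVneq (col i1 a) (col (s i1) x); last by exists i1.
  by exists i2; rewrite -s12 -e1 eq_sym; exact: a_distinct.
pose t := [ffun l => if l == i then j else s l].
pose y := \matrix_(l, c) (if c == j then a l i else x l c).
have := opt t y; apply/negP; rewrite -ltNge.
rewrite /cost (bigD1 i) //= [X in _ < X](bigD1 i) //=.
apply: ltr_leD; last first.
  apply: ler_sum => l li; rewrite ffunE (negbTE li).
  rewrite (_ : col (s l) y = col (s l) x) //.
  by apply/colP => c; rewrite !mxE (negbTE (s_j l)).
rewrite ffunE eqxx (_ : col j y = col i a); last first.
  by apply/colP => c; rewrite !mxE eqxx.
rewrite subrr enorm0 expr0n exprn_gt0 // lt_def enorm_ge0 andbT.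
by apply: contra off_center => /eqP/enorm0_eq0/eqP; rewrite subr_eq0.
Qed.

(** * Centroids *)

(* An empty cluster gets the center 0, since 0^-1 = 0. *)
Definition centroid s a : 'M[R]_(n, k) :=
  \matrix_(l, j) (#|[pred i | s i == j]|%:R^-1 * \sum_(i | s i == j) a l i).

Lemma col_centroid s a j :
  col j (centroid s a) =
  #|[pred i | s i == j]|%:R^-1 *: \sum_(i | s i == j) col i a.
Proof.
apply/colP => l; rewrite !mxE summxE; congr (_ * _).
by apply: eq_bigr => i _; rewrite mxE.
Qed.

Lemma centroidB s a b : centroid s (a - b) = centroid s a - centroid s b.
Proof.
apply/matrixP => l j; rewrite !mxE -mulrBr -sumrB; congr (_ * _).
by apply: eq_bigr => i _; rewrite !mxE.
Qed.

(** The triangle inequality in each cluster suffices, because the factor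
    [1 / (size of the cluster)] is at most 1. *)
Lemma sum_norm_centroid s a : sum_norm (centroid s a) <= sum_norm a.
Proof.
rewrite /sum_norm [leRHS](partition_big s xpredT) //=.
apply: ler_sum => j _; rewrite col_centroid enormZ.
apply: le_trans (enorm_sum _ _); apply: ler_piMl; first exact: enorm_ge0.
rewrite ger0_norm ?invr_ge0 ?ler0n //.
by case: #|_| => [|c]; rewrite ?invr0 ?ler01 // invf_le1 ?ltr0Sn // ler1n.
Qed.

Lemma sum_centroid s a l j :
  \sum_(i | s i == j) (a l i - centroid s a l j) = 0.
Proof.
rewrite sumrB.
have -> : \sum_(i | s i == j) centroid s a l j =
    #|[pred i | s i == j]|%:R * centroid s a l j.
  by rewrite sumr_const mulr_natl.
rewrite mxE.
have [c0|c0] := eqVneq #|[pred i | s i == j]| 0%N.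
  rewrite c0 mul0r subr0 big_pred0 // => i.
  by have := card0_eq c0 i; rewrite inE.
by rewrite mulrA divff ?pnatr_eq0 // mul1r subrr.
Qed.

(** The variance decomposition (Huygens, Steiner): the cross terms add up to 0
    in each cluster because the deviations from the centroid do. *)
Lemma cost_centroid s x a :
  cost s x a = cost s (centroid s a) a +
  \sum_(i < m) enorm (col (s i) (centroid s a) - col (s i) x) ^+ 2.
Proof.
move: (sum_centroid s a); move: (centroid s a) => c sum_dev.
have cross l : \sum_(i < m) (a l i - c l (s i)) * (c l (s i) - x l (s i)) = 0.
  rewrite (partition_big s xpredT) //= big1 // => j _.
  rewrite (eq_bigr (fun i => (a l i - c l j) * (c l j - x l j))); last first.
    by move=> i /eqP ->.
  by rewrite -mulr_suml sum_dev mul0r.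
transitivity (cost s c a +
    \sum_(i < m) enorm (col (s i) c - col (s i) x) ^+ 2 +
    2 * \sum_(l < n) \sum_(i < m) (a l i - c l (s i)) * (c l (s i) - x l (s i)));
  last by rewrite [X in 2 * X]big1 ?mulr0 ?addr0 // => l _; exact: cross.
rewrite exchange_big mulr_sumr -!big_split; apply: eq_bigr => i _.
rewrite !sqr_enorm mulr_sumr -!big_split; apply: eq_bigr => l _.
by rewrite !mxE /=; ring.
Qed.

(** By the variance decomposition, replacing [x] by the centroids lowers the cost
    by a sum of squared distances, which must vanish; surjectivity makes this
    sum see every center. *)
Lemma jointly_optimal_centroid s x a :
  (forall j, exists i, s i = j) -> jointly_optimal s x a ->
  x = centroid s a.
Proof.
move=> s_surj opt; have := opt s (centroid s a).
rewrite (cost_centroid s x) gerDl => le0.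
have ge0 (i : 'I_m) : true ->
    0 <= enorm (col (s i) (centroid s a) - col (s i) x) ^+ 2.
  by move=> _; exact: sqr_ge0.
have /eqP : \sum_(i < m) enorm (col (s i) (centroid s a) - col (s i) x) ^+ 2 = 0.
  by apply/eqP; rewrite eq_le le0 sumr_ge0.
rewrite psumr_eq0 // => /allP eq0.
apply/matrixP => l j; have [i <-] := s_surj j.
have := eq0 i (mem_index_enum i); rewrite sqrf_eq0 => /eqP/enorm0_eq0/colP/(_ l).
by rewrite !mxE => /eqP; rewrite subr_eq0 => /eqP ->.
Qed.

(** * Stability under perturbation of the data *)

(** Stated for centers [w a] that may move with the data, so that it covers both
    fixed centers and centroids. *)
Lemma cost_continuous s (w : 'M[R]_(n, m) -> 'M[R]_(n, k)) b (e : R) :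
  (forall a, sum_norm (w a - w b) <= sum_norm (a - b)) -> 0 < e ->
  exists2 d : R, 0 < d & forall a, sum_norm (a - b) < d ->
    `|cost s (w a) a - cost s (w b) b| < e.
Proof.
move=> w_lip e_gt0.
pose C := \sum_(i < m) 4 * (enorm (col i b - col (s i) (w b)) + 1).
have C_ge0 : 0 <= C.
  by apply: sumr_ge0 => i _; rewrite mulr_ge0 // addr_ge0 ?enorm_ge0.
have C1_gt0 : 0 < C + 1 by rewrite ltr_wpDl.
exists (Num.min 1 (e / (C + 1))); first by rewrite lt_min ltr01 divr_gt0.
move=> a; rewrite lt_min => /andP[r1]; rewrite ltr_pdivlMr // => rC.
have : `|cost s (w a) a - cost s (w b) b| <= C * sum_norm (a - b).
  rewrite /cost -sumrB mulr_suml; apply: le_trans (ler_norm_sum _ _ _) _.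
  apply: ler_sum => i _; apply: dist_sqr_enorm (ltW r1).
  (* The point and its center each move by at most the distance of the data. *)
  rewrite (_ : _ - _ = col i (a - b) + - col (s i) (w a - w b)); last first.
    by apply/colP => l; rewrite !mxE; ring.
  apply: le_trans (enormD _ _) _; rewrite enormN mulr_natl mulr2n lerD //.
    exact: enorm_col_le.
  exact: le_trans (enorm_col_le _ _) (w_lip a).
by have := sum_norm_ge0 (a - b); nra.
Qed.

(** If the conclusion fails, some pair [(t, y)] beats [(s, centroid s b)] for [b]
    by a positive gap, and by continuity it still wins for [a] once each of the
    two costs moves by less than half of the gap. *)
Lemma jointly_optimal_centroid_stable s b : exists2 d : R, 0 < d &
  forall a, sum_norm (a - b) < d ->
    jointly_optimal s (centroid s a) a ->
    jointly_optimal s (centroid s b) b.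
Proof.
have [opt|] := pselect (jointly_optimal s (centroid s b) b).
  by exists 1.
move=> /existsNP[t /existsNP[y /negP]]; rewrite -ltNge => lt_cost.
pose gap := cost s (centroid s b) b - cost t y b.
have gap2 : 0 < gap / 2 by rewrite divr_gt0 // subr_gt0.
have [d1 d1_gt0 near1] : exists2 d : R, 0 < d & forall a, sum_norm (a - b) < d ->
    `|cost s (centroid s a) a - cost s (centroid s b) b| < gap / 2.
  apply: cost_continuous => // a; rewrite -centroidB; exact: sum_norm_centroid.
have [d2 d2_gt0 near2] : exists2 d : R, 0 < d & forall a, sum_norm (a - b) < d ->
    `|cost t y a - cost t y b| < gap / 2.
  apply: (@cost_continuous t (fun=> y)) => // a.
  by rewrite subrr sum_norm0 sum_norm_ge0.
exists (Num.min d1 d2); first by rewrite lt_min d1_gt0.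
move=> a; rewrite lt_min => /andP[/near1 + /near2 +] /(_ t y).
by rewrite /gap !ltr_norml; lra.
Qed.

(** Two columns of [a - b] together carry at most the whole sum norm, so the
    distance between the columns [i] and [j] of [b] is itself a valid radius. *)
Lemma distinct_stable b (i j : 'I_m) : col i b != col j b ->
  exists2 d : R, 0 < d &
    forall a, sum_norm (a - b) < d -> col i a != col j a.
Proof.
move=> bij; exists (enorm (col i b - col j b)).
  rewrite lt_def enorm_ge0 andbT.
  by apply: contra bij => /eqP/enorm0_eq0/eqP; rewrite subr_eq0.
move=> a; apply: contraTneq => aij; rewrite -leNgt.
have ij : i != j by apply: contra bij => /eqP ->.
apply: le_trans (enorm_col2_le (a - b) ij); rewrite [leRHS]addrC.
rewrite -(enormN (col i (a - b))); apply: le_trans (enormD _ _).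
rewrite (_ : _ - _ = col j (a - b) - col i (a - b)) //.
by apply/colP => l; have /colP/(_ l) := aij; rewrite !mxE => ->; ring.
Qed.

End Cost.

Lemma uniform_radius (R : realType) (T : finType) (P : T -> R -> Prop) :
  (forall t, exists2 d : R, 0 < d & forall r, r < d -> P t r) ->
  exists2 d : R, 0 < d & forall t r, r < d -> P t r.
Proof.
move=> loc.
have /choice[d dP] : forall t, exists d : R,
    0 < d /\ forall r, r < d -> P t r.
  by move=> t; have [d] := loc t; exists d.
exists (\big[Num.min/1]_t d t).
  by apply: lt_bigmin => // t _; case: (dP t).
move=> t r /lt_le_trans rd; have [_] := dP t; apply; apply: rd.
exact: bigmin_le_cond.
Qed.

Theorem theorem6 (R : realType) (n m k : nat)
    (n_gt0 : (0 < n)%N) (m_gt0 : (0 < m)%N) (k_gt0 : (0 < k)%N)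
    (le_k_m : (k <= m)%N)
    (abar : 'M[R]_(n, m))
    (abar_distinct : forall i j : 'I_m, i != j -> col i abar != col j abar) :
  locally_upper_lipschitz (@solution_map R n m k) abar.
Proof.
have [d1 d1_gt0 stable] : exists2 d : R, 0 < d & forall s r, r < d ->
    forall a, sum_norm (a - abar) <= r ->
    jointly_optimal s (centroid s a) a ->
    @jointly_optimal R n m k s (centroid s abar) abar.
  apply: uniform_radius => s.
  have [d d_gt0 near] := jointly_optimal_centroid_stable s abar.
  by exists d => // r rd a ar; apply: near; exact: le_lt_trans rd.
have [d2 d2_gt0 distinct] : exists2 d : R, 0 < d &
    forall (ij : 'I_m * 'I_m) r, r < d ->
    forall a, sum_norm (a - abar) <= r -> ij.1 != ij.2 ->
    col ij.1 a != col ij.2 a.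
  apply: uniform_radius => -[i j] /=; have [<-|ij] := eqVneq i j; first by exists 1.
  have [d d_gt0 near] := distinct_stable (abar_distinct i j ij).
  by exists d => // r rd a ar _; apply: near; exact: le_lt_trans rd.
exists 1, (Num.min d1 d2); split=> //; first by rewrite lt_min d1_gt0.
move=> a; rewrite lt_min => /andP[ad1 ad2] x x_sol.
have [s opt] := solution_map_assignment m_gt0 k_gt0 x_sol.
have s_surj : forall j, exists i, s i = j.
  apply: jointly_optimal_surj opt => // i j.
  exact: (distinct (i, j) _ ad2 a).
have x_c := jointly_optimal_centroid s_surj opt; rewrite x_c in opt.
have [u ball_u uE] : exists2 u, @sum_ball R n k u &
    centroid s a - centroid s abar = sum_norm (a - abar) *: u.
  by apply: sum_ball_dilate; rewrite -centroidB; exact: sum_norm_centroid.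
exists (centroid s abar).
  exact: jointly_optimal_solution (stable s _ ad1 a _ opt).
by exists u => //; rewrite mul1r -uE x_c addrC subrK.
Qed.
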